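(* Let $\Delta$ be an additive subgroup of $\mathbb{C}$, let $b\in\mathbb{C}$ with $2b\notin\Delta$, and let $\varphi:\Delta\to\mathbb{C}^+$ be a group homomorphism. Let $CL_2(b,\varphi)=\bigoplus_{\alpha\in\Delta}\mathbb{C}[\partial]x_\alpha$ be the Lie conformal algebra, free as a $\mathbb{C}[\partial]$-module on $\{x_\alpha\mid\alpha\in\Delta\}$, with the $\lambda$-bracket $$[{x_\alpha}_\lambda x_\beta]=\big((\alpha+b)\partial+(\alpha+\beta+2b)\lambda\big)x_{\alpha+\beta}+\frac{1}{b}\big(\varphi(\alpha)\beta-\varphi(\beta)\alpha+b(\varphi(\alpha)-\varphi(\beta))\big)x_{\alpha+\beta}$$ for all $\alpha,\beta\in\Delta$. Then $CL_2(b,\varphi)$ is a simple Lie conformal algebra.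
   Context: $\mathbb{C}^+$ denotes the additive group of $\mathbb{C}$. A Lie conformal algebra is a $\mathbb{C}[\partial]$-module $R$ with a $\mathbb{C}$-bilinear $\lambda$-bracket $[\cdot_\lambda\cdot]:R\times R\to R[\lambda]=R\otimes\mathbb{C}[\lambda]$ such that for all $a,b,c\in R$: $[\partial a_\lambda b]=-\lambda[a_\lambda b]$ and $[a_\lambda\partial b]=(\lambda+\partial)[a_\lambda b]$; $[a_\lambda b]=-[b_{-\lambda-\partial}a]$; $[a_\lambda[b_\mu c]]=[[a_\lambda b]_{\lambda+\mu}c]+[b_\mu[a_\lambda c]]$. For subspaces $A,B\subset R$, $[A,B]$ is the $\mathbb{C}$-linear span of all coefficients (in powers of $\lambda$) of $[a_\lambda b]$, $a\in A$, $b\in B$. An ideal of $R$ is a $\mathbb{C}[\partial]$-submodule $I\subset R$ with $[R,I]\subset I$. $R$ is abelian if $[R,R]=0$, and simple if it is not abelian and its only ideals are $0$ and $R$. The $\lambda$-bracket given on the generators extends to the whole module by the identities $[\partial a_\lambda b]=-\lambda[a_\lambda b]$, $[a_\lambda\partial b]=(\lambda+\partial)[a_\lambda b]$. *)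

(* Defs.v *)
From HB Require Import structures.
From mathcomp Require Import all_boot all_order all_algebra.
From mathcomp Require Import finmap zify.
From mathcomp Require Import classical_sets reals complex.
From mathcomp.multinomials Require Import monalg.

Set Implicit Arguments.
Unset Strict Implicit.
Unset Printing Implicit Defensive.

Import GRing.Theory.
Local Open Scope ring_scope.

(* For a module V over A, [lpoly V] is V[t] = V (x) A[t]: the element P is    *)
(* \sum_n t^n P@_n. It is a module over {poly A}, with t = 'X.                *)
(* With A = K[d] and V = R this gives R[lambda] as a module over              *)
(* K[d][lambda] ('X%:P is d and 'X is lambda), and iterating the construction *)
(* gives R[lambda][mu] as a module over K[d][lambda][mu].                     *)
Definition lpoly (A : comNzRingType) (V : lmodType A) := {malg V[nat]}.

HB.instance Definition _ (A : comNzRingType) (V : lmodType A) :=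
  GRing.Zmodule.on (lpoly V).

Section LPoly.
Variables (A : comNzRingType) (V : lmodType A).
Implicit Types (q r : {poly A}) (P : lpoly V).

Definition lpoly_scale q P : lpoly V :=
  \sum_(i < size q) \sum_(n <- msupp P) << q`_i *: P@_n *g (i + n)%N >>.

Lemma mcoeff_lpoly_scale q P k :
  (lpoly_scale q P)@_k = \sum_(i < k.+1) q`_i *: P@_(k - i)%N.
Proof.
pose F i := if (i <= k)%N then q`_i *: P@_(k - i)%N else 0.
have inner i :
    (\sum_(n <- msupp P) << q`_i *: P@_n *g (i + n)%N >>)@_k = F i.
  rewrite raddf_sum /= /F; case: leqP => [le_ik | lt_ki]; last first.
    by rewrite big1 // => n _; rewrite mcoeffU; case: eqP => // e; lia.
  case: (msuppP P (k - i)%N) => [sP | sP].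
    rewrite (big_fsetD1 _ sP) /= subnKC // mcoeffUU big1_fset ?addr0 // => n.
    rewrite !inE => /andP[/eqP ne _] _; rewrite mcoeffU; case: eqP => // e.
    by case: ne; rewrite -e addKn.
  rewrite scaler0 big1_fset // => n sn _; rewrite mcoeffU; case: eqP => // e.
  by move: sP; rewrite -e addKn sn.
rewrite /lpoly_scale raddf_sum /=; under eq_bigr do rewrite inner.
pose m := maxn (size q) k.+1.
have -> : \sum_(i < size q) F i = \sum_(i < m) F i.
  rewrite (big_ord_widen m F) ?leq_maxl // big_mkcond /=.
  apply: eq_bigr => i _; case: ltnP => // /leq_sizeP /(_ _ (leqnn _)) qi.
  by rewrite /F qi scale0r if_same.
rewrite (big_ord_widen m (fun i => q`_i *: P@_(k - i)%N)) ?leq_maxr //.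
by rewrite [RHS]big_mkcond.
Qed.

Lemma lpoly_scaleA q r P :
  lpoly_scale q (lpoly_scale r P) = lpoly_scale (q * r) P.
Proof.
apply/malgP => k; rewrite !mcoeff_lpoly_scale.
pose G i j := (q`_i * r`_j) *: P@_(k - i - j)%N.
transitivity (\sum_(i < k.+1) \sum_(l < k.+1 | (i <= l)%N) G i (l - i)%N).
  apply: eq_bigr => i _; rewrite mcoeff_lpoly_scale scaler_sumr.
  have le_ik : (i <= k)%N by rewrite -ltnS.
  rewrite (eq_bigr (fun j : 'I__ => G i j)) => [|j _]; last by rewrite scalerA.
  rewrite -(big_mkord xpredT (G i)).
  rewrite -(big_mkord (fun l => i <= l)%N (fun l => G i (l - i)%N)).
  rewrite [RHS](@big_cat_nat _ _ _ i) ?leqW //=.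
  rewrite [X in _ = X + _](_ : _ = 0) ?add0r; last first.
    rewrite big_nat_cond big_pred0 // => l.
    by apply/negP => /andP[/andP[_ lt_li]]; rewrite leqNgt lt_li.
  rewrite -[X in _ = \sum_(X <= _ < _ | _) _]add0n big_addn subSn //.
  apply: eq_big => [j|j _]; first by rewrite leq_addl.
  by rewrite addnK.
rewrite (exchange_big_dep xpredT) //=; apply: eq_bigr => l _.
rewrite coefM scaler_suml.
rewrite (big_ord_widen k.+1 (fun i => (q`_i * r`_(l - i)%N) *: P@_(k - l)%N))//.
apply: eq_bigr => i le_il; rewrite /G; congr (_ *: P@__).
by rewrite -subnDA subnKC.
Qed.

Lemma lpoly_scale1 P : lpoly_scale 1 P = P.
Proof.
apply/malgP => k; rewrite mcoeff_lpoly_scale big_ord_recl /= coef1 scale1r subn0.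
by rewrite big1 ?addr0 // => i _; rewrite coef1 scale0r.
Qed.

Lemma lpoly_scaleDr q P P' :
  lpoly_scale q (P + P') = lpoly_scale q P + lpoly_scale q P'.
Proof.
apply/malgP => k; rewrite mcoeffD !mcoeff_lpoly_scale -big_split /=.
by apply: eq_bigr => i _; rewrite mcoeffD scalerDr.
Qed.

Lemma lpoly_scaleDl P q r :
  lpoly_scale (q + r) P = lpoly_scale q P + lpoly_scale r P.
Proof.
apply/malgP => k; rewrite mcoeffD !mcoeff_lpoly_scale -big_split /=.
by apply: eq_bigr => i _; rewrite coefD scalerDl.
Qed.

HB.instance Definition _ := GRing.Zmodule_isLmodule.Build {poly A} (lpoly V)
  lpoly_scaleA lpoly_scale1 lpoly_scaleDr lpoly_scaleDl.

Definition lconst (v : V) : lpoly V := << v *g 0%N >>.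

(* Substitution t := s, the coefficients being sent to W by j. *)
Definition lsubst (B : comNzRingType) (W : lmodType B) (s : B) (j : V -> W)
  (P : lpoly V) : W := \sum_(n <- msupp P) s ^+ n *: j P@_n.

End LPoly.

Section LieConformal.
Variables (K : fieldType) (V : lmodType {poly K}).
Implicit Types (br : V -> V -> lpoly V) (S I : set V).

Definition lbr_bilinear br : Prop :=
  (forall (c : K) u v w, br (c%:P *: u + v) w = c%:P%:P *: br u w + br v w) /\
  (forall (c : K) u v w, br u (c%:P *: v + w) = c%:P%:P *: br u v + br u w).

Definition lbr_sesquilinear br : Prop :=
  (forall u v, br ('X *: u) v = - 'X *: br u v) /\
  (forall u v, br u ('X *: v) = ('X + 'X%:P) *: br u v).

Definition lbr_skew br : Prop :=
  forall u v, br u v = - lsubst (- 'X - 'X%:P) (@lconst _ V) (br v u).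

Definition lbr_jacobi br : Prop :=
  let lam : {poly {poly {poly K}}} := 'X%:P in
  let mu : {poly {poly {poly K}}} := 'X in
  let cst (v : V) : lpoly (lpoly V) := lconst (lconst v) in
  forall u v w,
    lsubst mu (fun x => lsubst lam cst (br u x)) (br v w) =
      lsubst lam (fun x => lsubst (lam + mu) cst (br x w)) (br u v)
      + lsubst lam (fun x => lsubst mu cst (br v x)) (br u w).

Definition is_lie_conformal br : Prop :=
  [/\ lbr_bilinear br, lbr_sesquilinear br, lbr_skew br & lbr_jacobi br].

Definition scalar_span S : set V :=
  [set v | exists (n : nat) (c : 'I_n -> K) (s : 'I_n -> V),
      (forall i, S (s i)) /\ v = \sum_(i < n) (c i)%:P *: s i].

Definition lbr_span br S I : set V :=
  scalar_span [set w | exists (u v : V) (n : nat),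
                         [/\ S u, I v & w = (br u v)@_n]].

Definition is_ideal br I : Prop :=
  [/\ I 0,
      (forall (p : {poly K}) u v, I u -> I v -> I (p *: u + v))
    & (lbr_span br setT I `<=` I)%classic].

Definition is_abelian br : Prop := lbr_span br setT setT = [set 0]%classic.

Definition is_simple br : Prop :=
  ~ is_abelian br /\
  forall I, is_ideal br I -> I = [set 0]%classic \/ I = setT.

Definition is_simple_lie_conformal br : Prop :=
  is_lie_conformal br /\ is_simple br.

End LieConformal.

Definition addsubgroup (K : fieldType) (D : zmodClosed K) := {x : K | x \in D}.

HB.instance Definition _ (K : fieldType) (D : zmodClosed K) :=
  SubChoice.on (addsubgroup D).
HB.instance Definition _ (K : fieldType) (D : zmodClosed K) :=
  [SubChoice_isSubZmodule of addsubgroup D by <:].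

Section CL2.
Variables (K : fieldType) (D : zmodClosed K).

Definition CL2 := {malg {poly K}[addsubgroup D]}.

HB.instance Definition _ := GRing.Lmodule.on CL2.

Definition CL2_gen (a : addsubgroup D) : CL2 := << a >>.

Variables (b : K) (phi : {additive addsubgroup D -> K}).

Definition CL2_coef (a a' : addsubgroup D) : {poly {poly K}} :=
  let al := \val a in let be := \val a' in
  (al + b)%:P%:P * 'X%:P + (al + be + 2 * b)%:P%:P * 'X
  + (b^-1 * (phi a * be - phi a' * al + b * (phi a - phi a')))%:P%:P.

(* f |-> f(s), where the variable of f is d *)
Definition del_subst (s : {poly {poly K}}) (f : {poly K}) : {poly {poly K}} :=
  (map_poly (polyC \o polyC) f).[s].

(* The extension of the bracket of the generators to the whole module:        *)
(* [f(d)x_a _lambda g(d)x_a'] = f(-lambda) g(lambda + d) [x_a _lambda x_a'].  *)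
Definition CL2_br (u v : CL2) : lpoly CL2 :=
  \sum_(a <- msupp u) \sum_(a' <- msupp v)
    (del_subst (- 'X) u@_a * del_subst ('X + 'X%:P) v@_a' * CL2_coef a a')
      *: lconst (CL2_gen (a + a')).

Lemma CL2_br_gen (a a' : addsubgroup D) :
  CL2_br (CL2_gen a) (CL2_gen a')
  = CL2_coef a a' *: lconst (CL2_gen (a + a')).
Proof.
have del1 s : del_subst s 1 = 1.
  by rewrite /del_subst rmorph1 hornerE.
rewrite /CL2_br /CL2_gen !msuppU oner_eq0 !big_seq_fset1 !mcoeffUU.
by rewrite !del1 !mul1r.
Qed.

End CL2.

(* Main.v *)
(* Put psi = phi / b. The bracket of x_al and x_be has coefficient
     (al + b) (d + lambda - psi(be)) + (be + b) (lambda + psi(al)),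
   which is the case phi = 0 with d and lambda shifted additively in the
   degree. In each axiom both sides are additive in every argument and turn d
   into the same scalar, so it is enough to compare them on generators.
   For simplicity, every al + 2b is nonzero because 2b is not in D. If u is a
   nonzero element of an ideal, the top lambda-coefficient of [x_0 _lambda u]
   is a nonzero element with constant coefficients. On such elements the first
   lambda-coefficient of [x_0 _lambda -] is diagonal with pairwise distinct
   eigenvalues al + 2b, so some x_al is in the ideal, and [x_(be - al) _lambda
   x_al] then yields every x_be. *)

From HB Require Import structures.
Require Import Defs.
From mathcomp Require Import all_boot all_order all_algebra.
From mathcomp Require Import finmap ring boolp classical_sets reals complex.
From mathcomp.multinomials Require Import monalg.

Set Implicit Arguments.
Unset Strict Implicit.
Unset Printing Implicit Defensive.

Import GRing.Theory.
Local Open Scope ring_scope.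
Local Open Scope complex_scope.

(** * Finitely supported sums and maps that are semilinear along a ring morphism *)

Lemma msupp_sumw (G : zmodType) (I : choiceType) (W : nmodType)
    (F : I -> G -> W) (P : {malg G[I]}) (d : {fset I}) :
    (forall a, F a 0 = 0) -> (msupp P `<=` d)%fset ->
  \sum_(a <- msupp P) F a P@_a = \sum_(a <- d) F a P@_a.
Proof.
move=> F0 sPd; apply: big_fset_incl => // a _ /mcoeff_outdom ->; exact: F0.
Qed.

Section Semilinear.
Variables (A B : comNzRingType) (sigma : {rmorphism A -> B}).

(** The bracket turns [d] into [- lambda] in its left argument and into [lambda + d] in its right
    one, so it is linear only along a ring morphism. Recording that morphism makes the two sides of
    an axiom comparable. *)
Definition semilinear (V : lmodType A) (W : lmodType B) (f : V -> W) : Prop :=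
  forall a u v, f (a *: u + v) = sigma a *: f u + f v.

Section Basics.
Variables (V : lmodType A) (W : lmodType B) (f : V -> W).
Hypothesis fL : semilinear f.

Lemma semilinearD u v : f (u + v) = f u + f v.
Proof. by rewrite -[u in LHS]scale1r fL rmorph1 scale1r. Qed.

Lemma semilinear0 : f 0 = 0.
Proof. by apply: (addrI (f 0)); rewrite -semilinearD !addr0. Qed.

Lemma semilinearZ a u : f (a *: u) = sigma a *: f u.
Proof. by rewrite -[_ *: u]addr0 fL semilinear0 addr0. Qed.

Lemma semilinear_sum (I : Type) (r : seq I) (F : I -> V) :
  f (\sum_(i <- r) F i) = \sum_(i <- r) f (F i).
Proof. exact: (big_morph f semilinearD semilinear0). Qed.

Lemma semilinearN : semilinear (fun u => - f u).
Proof. by move=> a u v; rewrite fL opprD scalerN. Qed.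

End Basics.

Lemma semilinear_add (V : lmodType A) (W : lmodType B) (f g : V -> W) :
  semilinear f -> semilinear g -> semilinear (fun u => f u + g u).
Proof. by move=> fL gL a u v; rewrite fL gL scalerDr addrACA. Qed.

(** For an argument that occurs only inside the substituted map, as [u] in [[u_lambda [v_mu w]]]:
    since [B] is commutative, [sigma a] passes through the powers of [s]. *)
Lemma semilinear_lsubst_fun (C : comNzRingType) (V : lmodType A) (W : lmodType B)
    (U : lmodType C) (s : B) (f : V -> U -> W) (P : lpoly U) :
    (forall x, semilinear (f ^~ x)) ->
  semilinear (fun u => lsubst s (f u) P).
Proof.
move=> fL a u v; rewrite /lsubst scaler_sumr -big_split /=.
by apply: eq_bigr => n _; rewrite fL scalerDr !scalerA mulrC.
Qed.

Section MalgExt.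
Variables (I : choiceType) (W : lmodType B).

Lemma malgU_scale (c : A) (i : I) : << c *g i >> = c *: << i >> :> {malg A[I]}.
Proof.
by apply/malgP => k; rewrite mcoeffZ !mcoeffU mulrnAr mulr1.
Qed.

(** The [<< i >>] generate the module. This reduces skew-symmetry and the Jacobi identity to
    generators, once both sides are known to have the same twist [sigma]. *)
Lemma eq_semilinear_malg (f g : {malg A[I]} -> W) :
    semilinear f -> semilinear g -> (forall i, f << i >> = g << i >>) ->
  f =1 g.
Proof.
move=> fL gL fg u; rewrite [u]monalgE (semilinear_sum fL) (semilinear_sum gL).
apply: eq_bigr => i _; rewrite malgU_scale.
by rewrite (semilinearZ fL) (semilinearZ gL) fg.
Qed.

(** The supports involved differ, so all sums are first extended to the union of those of [u] and
    [v]; this adds only zeros because the hypothesis forces [F i 0 = 0]. *)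
Lemma semilinear_msupp_sum (F : I -> A -> W) :
    (forall i a x y, F i (a * x + y) = sigma a *: F i x + F i y) ->
  semilinear (fun u : {malg A[I]} => \sum_(i <- msupp u) F i u@_i).
Proof.
move=> FL a u v; have F0 i : F i 0 = 0.
  have := FL i 1 0 0; rewrite mulr0 addr0 rmorph1 scale1r -{1}[F i 0]addr0.
  by move/addrI.
pose d := (msupp u `|` msupp v)%fset.
rewrite !(msupp_sumw (d := d) F0) ?fsubsetUl ?fsubsetUr //.
  rewrite scaler_sumr -big_split /=.
  by apply: eq_bigr => i _; rewrite mcoeffD mcoeffZ FL.
apply: fsubset_trans (msuppD_le _ _) _.
exact: fsetSU (msuppZ_le _ _).
Qed.

End MalgExt.
End Semilinear.

Lemma semilinear_comp (A B C : comNzRingType) (sigma : {rmorphism A -> B})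
    (tau : {rmorphism B -> C}) (V : lmodType A) (W : lmodType B)
    (U : lmodType C) (f : V -> W) (g : W -> U) :
  semilinear sigma f -> semilinear tau g -> semilinear (tau \o sigma) (g \o f).
Proof. by move=> fL gL a u v; rewrite /= fL gL. Qed.

Lemma eq_semilinear (A B : comNzRingType) (sigma tau : {rmorphism A -> B})
    (V : lmodType A) (W : lmodType B) (f : V -> W) :
  sigma =1 tau -> semilinear sigma f -> semilinear tau f.
Proof. by move=> e fL a u v; rewrite fL e. Qed.

Lemma eq_poly_rmorphism (K B : comNzRingType) (f g : {rmorphism {poly K} -> B}) :
  (forall c, f c%:P = g c%:P) -> f 'X = g 'X -> f =1 g.
Proof.
move=> fgC fgX; elim/poly_ind => [|p c IHp]; first by rewrite !rmorph0.
by rewrite !rmorphD !rmorphM IHp fgC fgX.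
Qed.

(** * Substitution morphisms and substitution in [lpoly] *)

Section SubstMorph.
Variables (A B : comNzRingType) (sigma : {rmorphism A -> B}) (s : B).

(** The extension of [sigma] that sends ['X] to [s]. As a ring morphism it can be compared with
    other twists through [eq_poly_rmorphism]. *)
Definition subst_morph (q : {poly A}) : B := (map_poly sigma q).[s].

HB.instance Definition _ :=
  GRing.RMorphism.copy subst_morph (horner_eval s \o map_poly sigma).

Lemma subst_morphC c : subst_morph c%:P = sigma c.
Proof. by rewrite /subst_morph map_polyC hornerC. Qed.

Lemma subst_morphX : subst_morph 'X = s.
Proof. by rewrite /subst_morph map_polyX hornerX. Qed.

End SubstMorph.

Section LPolyTheory.
Variables (A : comNzRingType) (V : lmodType A).

Lemma lpoly_mcoeffZ (q : {poly A}) (P : lpoly V) k :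
  (q *: P)@_k = \sum_(i < k.+1) q`_i *: P@_(k - i)%N.
Proof. exact: mcoeff_lpoly_scale. Qed.

Lemma mcoeff_lconstZ (q : {poly A}) (v : V) k :
  (q *: lconst v)@_k = q`_k *: v.
Proof.
rewrite lpoly_mcoeffZ big_ord_recr /= subnn mcoeffUU big1 ?add0r // => i _.
by rewrite mcoeffU eq_sym subn_eq0 leqNgt ltn_ord mulr0n scaler0.
Qed.

Lemma semilinear_lconst : semilinear polyC (@lconst A V).
Proof.
move=> a u v; apply/malgP => k; rewrite mcoeffD mcoeff_lconstZ !mcoeffU coefC.
by rewrite eq_sym; case: eqP; rewrite ?mulr1n // !mulr0n scale0r addr0.
Qed.

Variables (B : comNzRingType) (W : lmodType B) (sigma : {rmorphism A -> B}).
Variables (s : B) (f : V -> W).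
Hypothesis fL : semilinear sigma f.

Lemma lsubstU v n : lsubst s f << v *g n >> = s ^+ n *: f v.
Proof.
rewrite /lsubst msuppU; case: eqP => [->|_].
  by rewrite big_seq_fset0 (semilinear0 fL) scaler0.
by rewrite big_seq_fset1 mcoeffUU.
Qed.

Lemma lsubst_lconst v : lsubst s f (lconst v) = f v.
Proof. by rewrite lsubstU expr0 scale1r. Qed.

Lemma lsubstD P Q : lsubst s f (P + Q) = lsubst s f P + lsubst s f Q.
Proof.
pose F n v := s ^+ n *: f v; have F0 n : F n 0 = 0.
  by rewrite /F (semilinear0 fL) scaler0.
pose d := (msupp P `|` msupp Q)%fset; rewrite /lsubst.
rewrite !(msupp_sumw (d := d) F0) ?fsubsetUl ?fsubsetUr ?msuppD_le //.
rewrite -big_split /=.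
by apply: eq_bigr => n _; rewrite mcoeffD /F (semilinearD fL) scalerDr.
Qed.

Lemma semilinear_lsubst :
  semilinear (subst_morph sigma s) (lsubst s f).
Proof.
move=> q P Q; rewrite lsubstD; congr (_ + _).
have lsubst0 : lsubst s f 0 = 0 by rewrite /lsubst msupp0 big_seq_fset0.
rewrite [q *: P]/(lpoly_scale q P) /lpoly_scale (big_morph _ lsubstD lsubst0).
(* Applying [sigma] may lower the degree of [q], so the evaluation is expanded over [size q] terms
   to match [lpoly_scale]. *)
rewrite /= /subst_morph (@horner_coef_wide _ (size q)) ?size_poly //.
rewrite scaler_suml; apply: eq_bigr => i _.
rewrite (big_morph _ lsubstD lsubst0) /lsubst scaler_sumr.
apply: eq_bigr => n _; rewrite -/(lsubst s f _) lsubstU (semilinearZ fL) !scalerA.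
by rewrite coef_map exprD mulrC mulrA.
Qed.

End LPolyTheory.

(** * The Lie conformal algebra axioms for [CL2] *)

Section CL2Lie.
Variables (K : fieldType) (D : zmodClosed K) (b : K).
Variable (phi : {additive addsubgroup D -> K}).

HB.instance Definition _ (s : {poly {poly K}}) :=
  GRing.RMorphism.copy (del_subst s) (horner_eval s \o map_poly (polyC \o polyC)).

Lemma del_substC s (c : K) : del_subst s c%:P = c%:P%:P.
Proof. by rewrite /del_subst map_polyC hornerC. Qed.

Lemma del_substX s : del_subst s 'X = s :> {poly {poly K}}.
Proof. by rewrite /del_subst map_polyX hornerX. Qed.

Local Notation br := (CL2_br b phi).

Lemma CL2_br_semilinear_r u : semilinear (del_subst ('X + 'X%:P)) (br u).
Proof.
move=> a v w; rewrite /CL2_br scaler_sumr -big_split /=.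
apply: eq_bigr => i _; pose F j x := (del_subst (- 'X) u@_i
  * del_subst ('X + 'X%:P) x * CL2_coef b phi i j) *: lconst (CL2_gen (i + j)).
apply: (@semilinear_msupp_sum _ _ _ _ _ F) => j c x y.
rewrite /F rmorphD rmorphM; move: (CL2_coef _ _ _ _) (del_subst _ u@_i) => p q.
by rewrite mulrDr mulrDl scalerDl scalerA mulrCA !mulrA.
Qed.

Lemma CL2_br_semilinear_l v : semilinear (del_subst (- 'X)) (br ^~ v).
Proof.
pose F i x := \sum_(j <- msupp v) (del_subst (- 'X) x
  * del_subst ('X + 'X%:P) v@_j * CL2_coef b phi i j) *: lconst (CL2_gen (i + j)).
apply: (@semilinear_msupp_sum _ _ _ _ _ F) => i c x y.
rewrite /F scaler_sumr -big_split /=; apply: eq_bigr => j _.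
rewrite rmorphD rmorphM; move: (CL2_coef _ _ _ _) (del_subst _ v@_j) => p q.
by rewrite !mulrDl scalerDl scalerA !mulrA.
Qed.

Lemma CL2_br_bilinear : lbr_bilinear br.
Proof.
split=> c u v w.
  by rewrite CL2_br_semilinear_l /= del_substC.
by rewrite CL2_br_semilinear_r /= del_substC.
Qed.

Lemma CL2_br_sesquilinear : lbr_sesquilinear br.
Proof.
split=> u v.
  by rewrite (semilinearZ (CL2_br_semilinear_l v)) /= del_substX.
by rewrite (semilinearZ (CL2_br_semilinear_r u)) /= del_substX.
Qed.

Hypothesis b_neq0 : b != 0.

(* The coefficient of [x_al _lambda x_be], with d = t, lambda = s, c = b,
   ps = phi(al) / b and qs = phi(be) / b. *)
Definition structure_coef (S : comNzRingType) (c al ps be qs t s : S) : S :=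
  (al + c) * t + (al + be + 2 * c) * s + (ps * (be + c) - qs * (al + c)).

(** This is the Jacobi identity on generators. In each double bracket the [d] of the inner result
    takes the value imposed by the outer bracket: [l + d] or [m + d] in the right slot, [- (l + m)]
    in the left one. *)
Lemma structure_coef_jacobi (S : comNzRingType) (c al ps be qs ga rs d l m : S) :
  structure_coef c be qs ga rs (l + d) m
    * structure_coef c al ps (be + ga) (qs + rs) d l =
  structure_coef c al ps be qs (- (l + m)) l
    * structure_coef c (al + be) (ps + qs) ga rs d (l + m)
  + structure_coef c al ps ga rs (m + d) l
    * structure_coef c be qs (al + ga) (ps + rs) d m.
Proof. rewrite /structure_coef; ring. Qed.

(** Written with [phi / b], the coefficient is polynomial in its data, so a ring morphism acts on it
    through its arguments. Here [b != 0] serves to cancel [b^-1 * b]. *)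
Lemma CL2_coef_rmorph (S : comNzRingType) (tau : {rmorphism {poly {poly K}} -> S})
    (iota : {rmorphism K -> S}) (i j : addsubgroup D) :
    (forall c, tau c%:P%:P = iota c) ->
  tau (CL2_coef b phi i j) =
    structure_coef (iota b) (iota (\val i)) (iota (phi i / b))
      (iota (\val j)) (iota (phi j / b)) (tau 'X%:P) (tau 'X).
Proof.
move=> tauC; rewrite /CL2_coef.
rewrite (_ : b^-1 * _ = phi i / b * (\val j + b) - phi j / b * (\val i + b));
  last by field.
rewrite rmorphD rmorphD (rmorphM tau) (rmorphM tau) !tauC.
by rewrite !(rmorphD, rmorphM, rmorphN, rmorph1, rmorphMn).
Qed.

Lemma CL2_br_skew : lbr_skew br.
Proof.
(* [tau] sends [lambda] to [- lambda - d] and fixes [d]. It exchanges [- lambda] and [lambda + d],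
   the twists of the two slots, so both sides of skew-symmetry have the same twist. *)
pose tau : {rmorphism _ -> {poly {poly K}}} := subst_morph polyC (- 'X - 'X%:P).
have lL : semilinear tau _ := semilinear_lsubst _ (@semilinear_lconst _ (CL2 D)).
have tauC c : tau c%:P%:P = (polyC \o polyC) c by rewrite /tau /= subst_morphC.
have tauX : tau 'X = - 'X - 'X%:P by rewrite /tau /= subst_morphX.
have tauY : tau 'X%:P = 'X%:P by rewrite /tau /= subst_morphC.
move: tau lL tauC tauX tauY => tau lL tauC tauX tauY.
move=> u v; move: u; apply: (eq_semilinear_malg (CL2_br_semilinear_l v)).
  apply: semilinearN.
  apply: eq_semilinear (semilinear_comp (CL2_br_semilinear_r v) lL).
  apply: eq_poly_rmorphism => [c|] /=; first by rewrite !del_substC tauC.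
  by rewrite !del_substX rmorphD tauX tauY addrNK.
move=> i; move: v; apply: (eq_semilinear_malg (CL2_br_semilinear_r _)).
  apply: semilinearN.
  apply: eq_semilinear (semilinear_comp (CL2_br_semilinear_l _) lL).
  apply: eq_poly_rmorphism => [c|] /=; first by rewrite !del_substC tauC.
  by rewrite !del_substX rmorphN tauX; ring.
move=> j; rewrite !CL2_br_gen (semilinearZ lL).
rewrite (lsubst_lconst _ (@semilinear_lconst _ _)).
rewrite -scaleNr [in RHS]addrC; congr (_ *: _).
rewrite (CL2_coef_rmorph _ _ tauC) tauX tauY.
have /= -> := @CL2_coef_rmorph _ idfun (polyC \o polyC) i j (fun=> erefl).
rewrite /structure_coef; ring.
Qed.

Definition CL2_cst (v : CL2 D) : lpoly (lpoly (CL2 D)) := lconst (lconst v).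

Lemma CL2_cst_semilinear : semilinear (polyC \o polyC) CL2_cst.
Proof.
exact: semilinear_comp (@semilinear_lconst _ (CL2 D))
  (@semilinear_lconst _ (lpoly (CL2 D))).
Qed.

Section Substitution.
Variables (S : comNzRingType) (iota : {rmorphism K -> S}) (W : lmodType S).
Variables (t : S) (f : CL2 D -> W).
Hypothesis fL : semilinear (subst_morph iota t) f.

(** Here [t] is the value of [d] and [s] that of [lambda]. The resulting map again satisfies the
    hypothesis on [f], with [s + t] for [t], so the lemma can be iterated on nested brackets. *)
Lemma lsubst_semilinear_r s u :
  semilinear (subst_morph iota (s + t)) (fun v => lsubst s f (br u v)).
Proof.
apply: eq_semilinear (semilinear_comp (CL2_br_semilinear_r u)
  (semilinear_lsubst s fL)).
apply: eq_poly_rmorphism => [c|] /=.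
  by rewrite del_substC !subst_morphC /= subst_morphC.
by rewrite del_substX rmorphD /= !subst_morphX !subst_morphC /= subst_morphX.
Qed.

Lemma lsubst_semilinear_l s v :
  semilinear (subst_morph iota (- s)) (fun u => lsubst s f (br u v)).
Proof.
apply: eq_semilinear (semilinear_comp (CL2_br_semilinear_l v)
  (semilinear_lsubst s fL)).
apply: eq_poly_rmorphism => [c|] /=.
  by rewrite del_substC !subst_morphC /= subst_morphC.
by rewrite del_substX rmorphN /= !subst_morphX.
Qed.

Lemma lsubst_CL2_br_gen s i j :
  lsubst s f (br (CL2_gen i) (CL2_gen j)) =
    structure_coef (iota b) (iota (\val i)) (iota (phi i / b))
      (iota (\val j)) (iota (phi j / b)) t s *: f (CL2_gen (i + j)).
Proof.
rewrite CL2_br_gen (semilinearZ (semilinear_lsubst s fL)).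
rewrite (lsubst_lconst _ fL) (@CL2_coef_rmorph _ _ iota).
  by rewrite /= subst_morphX subst_morphC /= subst_morphX.
by move=> c; rewrite /= !subst_morphC /= subst_morphC.
Qed.

End Substitution.

Lemma CL2_br_jacobi : lbr_jacobi br.
Proof.
rewrite /lbr_jacobi -/CL2_cst; set lam := 'X%:P; set mu := 'X.
pose iota : {rmorphism K -> {poly {poly {poly K}}}} := polyC \o (polyC \o polyC).
pose d : {poly {poly {poly K}}} := 'X%:P%:P.
have cstL : semilinear (subst_morph iota d) CL2_cst.
  apply: eq_semilinear CL2_cst_semilinear.
  by apply: eq_poly_rmorphism => [c|]; rewrite /= ?subst_morphC ?subst_morphX.
(* Nested brackets produce the value of [d] in different but equal forms; [castL] changes one into
   another. *)
have castL (W : lmodType {poly {poly {poly K}}}) t t' (f : CL2 D -> W) :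
    t = t' -> semilinear (subst_morph iota t) f ->
    semilinear (subst_morph iota t') f by move=> <-.
pose inL s w := lsubst_semilinear_l cstL s w.
pose inR s u := lsubst_semilinear_r cstL s u.
(* On both sides [d] becomes [lambda + mu + d] when pulled out of [w], [- mu] out of [v] and
   [- lambda] out of [u]. *)
move=> u v w; move: w.
apply: (eq_semilinear_malg (sigma := subst_morph iota (lam + mu + d))).
- by apply: castL (lsubst_semilinear_r (inR _ _) _ _); ring.
- apply: semilinear_add.
    by apply: semilinear_lsubst_fun => x; exact: inR.
  by apply: castL (lsubst_semilinear_r (inR _ _) _ _); ring.
move=> k; move: v.
apply: (eq_semilinear_malg (sigma := subst_morph iota (- mu))).
- exact: lsubst_semilinear_l (inR _ _) _ _.
- apply: semilinear_add.
    by apply: castL (lsubst_semilinear_r (inL _ _) _ _); ring.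
  by apply: semilinear_lsubst_fun => x; exact: inL.
move=> j; move: u.
apply: (eq_semilinear_malg (sigma := subst_morph iota (- lam))).
- by apply: semilinear_lsubst_fun => x; exact: inL.
- apply: semilinear_add; first exact: lsubst_semilinear_l (inL _ _) _ _.
  exact: lsubst_semilinear_l (inR _ _) _ _.
move=> i.
have valD (x y : addsubgroup D) : iota (\val (x + y)) = iota (\val x) + iota (\val y).
  by rewrite -rmorphD.
have phiD (x y : addsubgroup D) :
    iota (phi (x + y) / b) = iota (phi x / b) + iota (phi y / b).
  by rewrite raddfD mulrDl rmorphD.
(* Each double bracket of generators is computed in two moves, the inner bracket first, which yields
   a product of two structure coefficients. *)
have scaled2 (x y z : lpoly (lpoly (CL2 D))) (p q : {poly {poly {poly K}}}) :
  x = p *: y -> y = q *: z -> x = (p * q) *: z by move=> -> ->; rewrite scalerA.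
have E1 := scaled2 _ _ _ _ _
  (lsubst_CL2_br_gen (inR lam (CL2_gen i)) mu j k)
  (lsubst_CL2_br_gen cstL lam i (j + k)).
have E2 := scaled2 _ _ _ _ _
  (lsubst_CL2_br_gen (inL (lam + mu) (CL2_gen k)) lam i j)
  (lsubst_CL2_br_gen cstL (lam + mu) (i + j) k).
have E3 := scaled2 _ _ _ _ _
  (lsubst_CL2_br_gen (inR mu (CL2_gen j)) lam i k)
  (lsubst_CL2_br_gen cstL mu j (i + k)).
apply: (etrans E1); apply/esym; apply: (etrans (congr2 +%R E2 E3)).
(* The three resulting degrees agree up to rearrangement, so only the scalars remain to be
   compared. *)
rewrite (addrCA j i k) (addrA i j k) -scalerDl !valD !phiD.
congr (_ *: _); apply/esym; exact: structure_coef_jacobi.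
Qed.

Lemma CL2_is_lie_conformal : is_lie_conformal br.
Proof.
split; [exact: CL2_br_bilinear | exact: CL2_br_sesquilinear
  | exact: CL2_br_skew | exact: CL2_br_jacobi].
Qed.

End CL2Lie.

(** * Ideals of [CL2] and simplicity *)

Lemma exists_msupp (I : choiceType) (G : zmodType) (u : {malg G[I]}) :
  u != 0 -> exists i, i \in msupp u.
Proof.
move=> u0; apply/fset0Pn; apply: contraNN u0 => /eqP u0.
by rewrite [u]monalgE u0 big_seq_fset0.
Qed.

Section CL2Simple.
Variables (K : fieldType) (D : zmodClosed K) (b : K).
Variable (phi : {additive addsubgroup D -> K}).
Hypothesis b2_notin : 2 * b \notin D.
Local Notation br := (CL2_br b phi).

Lemma CL2_shift_neq0 (i : addsubgroup D) : \val i + 2 * b != 0.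
Proof.
apply: contra b2_notin; rewrite addrC addr_eq0 => /eqP ->.
by rewrite rpredN; exact: (valP i).
Qed.

Lemma CL2_b_neq0 : b != 0.
Proof. by apply: contra b2_notin => /eqP ->; rewrite mulr0 rpred0. Qed.

(** The total degree of [f(lambda + d)] in [lambda] and [d] is at most [n], so its coefficient of
    [lambda ^ n] is free of [d]. *)
Lemma coef_del_subst_shift (f : {poly K}) n : (size f <= n.+1)%N ->
  (del_subst ('X + 'X%:P) f)`_n = (f`_n)%:P.
Proof.
elim/poly_ind: f n => [|f c IHf] n; first by rewrite rmorph0 !coef0.
have [-> | f0 sf] := eqVneq f 0.
  by rewrite mul0r add0r del_substC !coefC; case: ifP.
have {}sf : (size f <= n)%N.
  by move: sf; rewrite size_MXaddC (negPf f0) ltnS.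
rewrite rmorphD rmorphM /= del_substX del_substC mulrDr !coefD coefMX coefMC !coefC.
rewrite (IHf n (leqW sf)) (nth_default 0 sf) polyC0 mul0r addr0 coefMX.
case: n sf => [|n] sf /=; first by rewrite !add0r.
by rewrite IHf // !addr0.
Qed.

(** The components have degree at most [n] in [d], so [lambda ^ n.+1] arises only from [lambda ^ n]
    times the [lambda] term of [CL2_coef]. For [n = 0] this is the diagonal action on elements with
    constant coefficients. *)
Lemma mcoeff_CL2_br_top (u : CL2 D) n (a : addsubgroup D) :
    (forall i, size u@_i <= n.+1)%N ->
  (br (CL2_gen 0) u)@_n.+1@_a = (u@_a`_n * (\val a + 2 * b))%:P.
Proof.
move=> su; rewrite /CL2_br /CL2_gen msuppU oner_eq0 big_seq_fset1 mcoeffUU.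
rewrite rmorph1 raddf_sum /= raddf_sum /=.
have E (j : addsubgroup D) :
    ((1 * del_subst ('X + 'X%:P) u@_j * CL2_coef b phi 0 j) *:
       lconst << (0 + j) >>)@_n.+1@_a
    = (u@_j`_n * (\val j + 2 * b))%:P *+ (j == a).
  rewrite mcoeff_lconstZ add0r mcoeffZ mcoeffU mulrnAr mulr1; congr (_ *+ _).
  rewrite mul1r /CL2_coef raddf0 add0r -[_ + _ + (_)%:P%:P]addrAC -polyCM -polyCD.
  rewrite mulrDr coefD mulrA coefMX !coefMC !coef_del_subst_shift //=.
  rewrite (nth_default 0 (su j)) polyC0 mul0r add0r -polyCM ?add0r //.
  exact: leqW.
rewrite (eq_bigr _ (fun j _ => E j)).
have [sa | na] := boolP (a \in msupp u).
  rewrite (big_fsetD1 a) //= eqxx big1_fset ?addr0 // => i.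
  by rewrite !inE => /andP[/negPf -> _] _.
rewrite (mcoeff_outdom na) coef0 mul0r big1_fset // => i si _.
by case: eqP => // ia; rewrite ia (negPf na) in si.
Qed.

Lemma mcoeff_CL2_br_gen1 (i j : addsubgroup D) :
  (br (CL2_gen i) (CL2_gen j))@_1%N =
    (\val (i + j) + 2 * b)%:P *: CL2_gen (i + j).
Proof.
rewrite CL2_br_gen mcoeff_lconstZ; congr (_ *: _).
rewrite /CL2_coef !coefD coefMC coefMX !coefC /=.
by rewrite mul0r add0r addr0.
Qed.

Lemma CL2_not_abelian : ~ is_abelian br.
Proof.
(* This is [2 * b] times [x_0]. *)
pose v := (br (CL2_gen 0) (CL2_gen 0))@_1%N.
move=> ab; have : lbr_span br setT setT v.
  exists 1%N, (fun=> 1), (fun=> v); split; last by rewrite big_ord1 scale1r.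
  by move=> _; exists (CL2_gen 0), (CL2_gen 0), 1%N.
rewrite [lbr_span _ _ _]ab => /(congr1 (mcoeff 0)) /eqP.
rewrite /v mcoeff_CL2_br_gen1 mcoeffZ addr0 mcoeffUU mulr1 mcoeff0 polyC_eq0.
by rewrite (negPf (CL2_shift_neq0 0)).
Qed.

Section Ideal.
Variable I : set (CL2 D).
Hypothesis II : is_ideal br I.

Lemma ideal_scale p u : I u -> I (p *: u).
Proof. by case: II => I0 IL _ Iu; rewrite -[_ *: _]addr0; exact: IL. Qed.

Lemma ideal_sum (T : Type) (r : seq T) (F : T -> CL2 D) :
  (forall i, I (F i)) -> I (\sum_(i <- r) F i).
Proof.
case: II => I0 IL _ IF; apply: (big_ind I) => // u v Iu Iv.
by rewrite -[u]scale1r; exact: IL.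
Qed.

Lemma ideal_mcoeff u v n : I v -> I (br u v)@_n.
Proof.
case: II => _ _ IS Iv; apply: IS; exists 1%N, (fun=> 1), (fun=> (br u v)@_n).
split; [by move=> _; exists u, v, n | by rewrite big_ord1 scale1r].
Qed.

Lemma ideal_gen_full i : I (CL2_gen i) -> I = setT.
Proof.
move=> Ii; have Igen j : I (CL2_gen j).
  have := ideal_mcoeff (CL2_gen (j - i)) 1%N Ii.
  rewrite mcoeff_CL2_br_gen1 subrK => /(ideal_scale (\val j + 2 * b)^-1%:P).
  by rewrite scalerA -polyCM mulVf ?CL2_shift_neq0 // scale1r.
apply/seteqP; split=> // u _; rewrite [u]monalgE.
by apply: ideal_sum => j; rewrite malgU_scale; exact: (ideal_scale _ (Igen j)).
Qed.

(** Induction on the size of the support: a diagonal operator minus one of its eigenvalues removes a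
    term, until a multiple of one generator is left. *)
Lemma ideal_const_gen (u : CL2 D) : I u -> u != 0 ->
  (forall i, size u@_i <= 1)%N -> exists i, I (CL2_gen i).
Proof.
have [m] := ubnP #|` msupp u|; elim: m => // m IHm in u *.
rewrite ltnS => um Iu u0 su.
have [i si] := exists_msupp u0.
have uC j : u@_j = (u@_j`_0)%:P by exact: size1_polyC.
have [/eqP ui | ] := eqVneq (msupp u) [fset i]%fset.
  exists i; have ui0 : u@_i`_0 != 0 by rewrite -polyC_eq0 -uC mcoeff_neq0.
  have := ideal_scale (u@_i`_0)^-1%:P Iu.
  rewrite {2}[u]monalgE (eqP ui) big_seq_fset1 malgU_scale uC coefC /= scalerA.
  by rewrite -polyCM mulVf // scale1r.
rewrite eq_sym eqEfsubset fsub1set si /= => /fsubsetPn[j sj].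
rewrite inE => nij.
(* Subtracting the eigenvalue at [i] kills the component there, while the one at [j] is multiplied
   by the nonzero difference of the degrees. Hence [v] is nonzero with strictly smaller support. *)
pose v : CL2 D := - (\val i + 2 * b)%:P *: u + (br (CL2_gen 0) u)@_1%N.
have vE k : v@_k = (u@_k`_0 * (\val k - \val i))%:P.
  rewrite /v mcoeffD mcoeffZ mcoeff_CL2_br_top // [in X in X + _]uC.
  by rewrite -polyCN -polyCM -polyCD; congr _%:P; ring.
apply: (IHm v).
- apply: leq_trans um; apply: fproper_ltn_card; rewrite fproperE; apply/andP; split.
    apply/fsubsetP => k; rewrite -!mcoeff_neq0 vE; apply: contraNneq => ->.
    by rewrite coef0 mul0r.
  by apply/fsubsetPn; exists i => //; rewrite -mcoeff_eq0 vE subrr mulr0.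
- by case: II => _ IL _; apply: IL => //; exact: ideal_mcoeff.
- apply: contraNneq nij => v0; have := vE j; rewrite v0 mcoeff0 => /esym/eqP.
  rewrite polyC_eq0 mulf_eq0 -polyC_eq0 -uC (negPf (_ : u@_j != 0)) ?mcoeff_neq0 //=.
  by rewrite subr_eq0.
- by move=> k; rewrite vE size_polyC leq_b1.
Qed.

Lemma ideal_gen (u : CL2 D) : I u -> u != 0 -> exists i, I (CL2_gen i).
Proof.
move=> Iu u0; pose P n := all (fun i => size u@_i <= n)%N (msupp u).
have exP : exists n, P n.
  exists (\max_(i <- msupp u) size u@_i)%N.
  by apply/allP => i si; exact: leq_bigmax_seq.
(* A least bound [n = 0] would make every component of [u] zero. *)
case: (ex_minnP exP) => n /allP su minP; case: n => [|n] in su minP *.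
  have [i si] := exists_msupp u0.
  by move: (si); rewrite -mcoeff_neq0 -size_poly_leq0 su.
have {}su i : (size u@_i <= n.+1)%N.
  by case: (msuppP u i) => [/su | _] //; rewrite size_poly0.
(* Minimality of [n.+1] gives a component of exactly this size; its leading coefficient makes [v]
   below nonzero. *)
have /allPn[i si] : ~~ P n by apply/negP => /minP; rewrite ltnn.
rewrite -ltnNge => lti; have ni : size u@_i = n.+1 by apply/eqP; rewrite eqn_leq su.
pose v := (br (CL2_gen 0) u)@_n.+1.
apply: (@ideal_const_gen v).
- exact: ideal_mcoeff.
- apply/eqP => /(congr1 (mcoeff i)) /eqP.
  rewrite mcoeff_CL2_br_top // mcoeff0 polyC_eq0 mulf_eq0.
  rewrite (negPf (CL2_shift_neq0 i)) orbF -[n]/(n.+1.-1) -ni -/(lead_coef _).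
  by rewrite lead_coef_eq0 mcoeff_eq0 si.
- by move=> k; rewrite mcoeff_CL2_br_top // size_polyC leq_b1.
Qed.

End Ideal.

Lemma CL2_is_simple : is_simple br.
Proof.
split; first exact: CL2_not_abelian.
move=> I II; have [[u Iu unz] | nI] := pselect (exists2 u, I u & u != 0).
  by right; have [k Ik] := ideal_gen II Iu unz; exact: ideal_gen_full Ik.
left; apply/seteqP; split=> [u Iu | _ ->]; last by case: II.
by apply/eqP/negPn/negP => u0; apply: nI; exists u.
Qed.

End CL2Simple.

Theorem theorem4p8 (R : realType) (D : zmodClosed R[i]) (b : R[i])
    (hb : 2 * b \notin D) (phi : {additive addsubgroup D -> R[i]}) :
  is_simple_lie_conformal (CL2_br b phi).
Proof.
split; first exact: CL2_is_lie_conformal (CL2_b_neq0 hb).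
exact: CL2_is_simple.
Qed.
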